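(* Let $(\bar x,\bar y)\in\mathbb{R}^n\times\mathbb{R}^m$ be such that $\Lambda(\bar x,\bar y,\bar y)\neq\emptyset$ and $(\bar x,\bar y,\bar y,\bar u,\bar v)$ is locally optimal to (MDP) for every $(\bar u,\bar v)\in\Lambda(\bar x,\bar y,\bar y)$. Suppose that weak Mond-Weir duality holds for $(\mathrm{P}_{\bar x})$ and $(\mathrm{MD}_{\bar x})$, and that, for all $(x,y)$ near $(\bar x,\bar y)$ with $y\in S(x)$, $(\mathrm{P}_x)$ satisfies the MFCQ at $y$. Then $(\bar x,\bar y)$ is locally optimal to (BP).
   Context: Data: $\Omega\subseteq\mathbb{R}^{n+m}$ is a set; $F:\mathbb{R}^{n+m}\to\mathbb{R}$ is continuously differentiable; $f:\mathbb{R}^{n+m}\to\mathbb{R}$, $g:\mathbb{R}^{n+m}\to\mathbb{R}^p$, $h:\mathbb{R}^{n+m}\to\mathbb{R}^q$ are twice continuously differentiable. For $x\in\mathbb{R}^n$, the lower-level problem is $(\mathrm{P}_x)$: $\min_y f(x,y)$ s.t. $g(x,y)\le 0$, $h(x,y)=0$; its feasible set is $Y(x)=\{y\in\mathbb{R}^m: g(x,y)\le0,\ h(x,y)=0\}$ and its set of (global) optimal solutions is $S(x)$. Let $X=\{x\in\mathbb{R}^n:\exists y\in\mathbb{R}^m,\ (x,y)\in\Omega\}$. Standing assumption: $S(x)\ne\emptyset$ for each $x\in X$. The bilevel program is (BP): $\min F(x,y)$ s.t. $(x,y)\in\Omega$, $y\in S(x)$. Lagrangian: $L(x,z,u,v)=f(x,z)+u^Tg(x,z)+v^Th(x,z)$;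 $\nabla_z$ denotes the gradient with respect to the second block of variables, and for vector-valued maps the matrix whose columns are the gradients of the components. The lower-level Mond-Weir dual is $(\mathrm{MD}_x)$: $\max_{z,u,v} f(x,z)$ s.t. $\nabla_zL(x,z,u,v)=0$, $u^Tg(x,z)+v^Th(x,z)\ge0$, $u\ge0$; its feasible set is $M(x)$. Weak Mond-Weir duality for $(\mathrm{P}_x)$ and $(\mathrm{MD}_x)$ means $f(x,y')\ge f(x,z')$ for all $y'\in Y(x)$ and $(z',u',v')\in M(x)$. (MDP): minimize $F(x,y)$ over $(x,y,z,u,v)\in\mathbb{R}^n\times\mathbb{R}^m\times\mathbb{R}^m\times\mathbb{R}^p\times\mathbb{R}^q$ s.t. $(x,y)\in\Omega$, $g(x,y)\le0$, $h(x,y)=0$, $f(x,y)-f(x,z)\le0$, $u^Tg(x,z)+v^Th(x,z)\ge0$, $\nabla_zf(x,z)+\nabla_zg(x,z)u+\nabla_zh(x,z)v=0$, $u\ge0$. $\Lambda(x,y,z)$ is the set of all $(u,v)\in\mathbb{R}^{p+q}$ with $f(x,y)-f(x,z)\le0$, $\nabla_zL(x,z,u,v)=0$, $u^Tg(x,z)+v^Th(x,z)\ge0$, $u\ge0$. A point is locally optimal if it is feasible and its objective value is no larger than that of every feasible point in some neighborhood of it. ''For all $(x,y)$ near $(\bar x,\bar y)$'' means for all $(x,y)$ in some neighborhood of $(\bar x,\bar y)$. $(\mathrm{P}_x)$ satisfies the MFCQ (Mangasarian-Fromovitz constraint qualification) at $y\in Y(x)$ if the gradients $\nabla_yh_j(x,y)$,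 $j=1,\dots,q$, are linearly independent and there is $d\in\mathbb{R}^m$ with $\nabla_yg_i(x,y)^Td<0$ for all $i$ with $g_i(x,y)=0$ and $\nabla_yh_j(x,y)^Td=0$ for $j=1,\dots,q$. *)

(* Defs.v *)
From HB Require Import structures.
From mathcomp Require Import all_boot all_order all_algebra.
From mathcomp Require Import all_classical all_reals all_analysis.

Set Implicit Arguments.
Unset Strict Implicit.
Unset Printing Implicit Defensive.

Import Order.TTheory GRing.Theory Num.Theory.
Import numFieldNormedType.Exports.

Local Open Scope classical_set_scope.
Local Open Scope ring_scope.

(* A vector of R^k is a row vector, so that a matrix-vector product [M u] reads
   [u *m M^T], and the point (x, y) of R^(n + m) is [row_mx x y]. *)

Section Calculus.
Context {R : realType}.

Definition dotv {k : nat} (u w : 'rV[R]_k) : R := \sum_i u 0 i * w 0 i.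

Definition grad {k : nat} (f : 'rV[R]_k -> R) (a : 'rV[R]_k) : 'rV[R]_k :=
  \row_i 'D_(delta_mx 0 i) f a.

Definition C1 {k : nat} (f : 'rV[R]_k -> R) : Prop :=
  (forall a, differentiable f a) /\ continuous (grad f).

Definition C2 {k : nat} (f : 'rV[R]_k -> R) : Prop :=
  C1 f /\ forall i, C1 (fun a => grad f a 0 i).

Definition C2_vec {k l : nat} (g : 'rV[R]_k -> 'rV[R]_l) : Prop :=
  forall j, C2 (fun a => g a 0 j).

Definition locally_optimal {T : topologicalType} (feasible : set T)
    (objective : T -> R) (a : T) : Prop :=
  feasible a /\ \forall b \near a, feasible b -> objective a <= objective b.

End Calculus.

Section Bilevel.
Context {R : realType} {n m p q : nat}.
Variables (Omega : set 'rV[R]_(n + m)) (F f : 'rV[R]_(n + m) -> R).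
Variables (g : 'rV[R]_(n + m) -> 'rV[R]_p) (h : 'rV[R]_(n + m) -> 'rV[R]_q).

Definition lower_feasible (x : 'rV[R]_n) : set 'rV[R]_m :=
  [set y | (forall i, g (row_mx x y) 0 i <= 0) /\ h (row_mx x y) = 0].

Definition lower_solutions (x : 'rV[R]_n) : set 'rV[R]_m :=
  [set y | lower_feasible x y /\
    forall y', lower_feasible x y' -> f (row_mx x y) <= f (row_mx x y')].

Definition upper_domain : set 'rV[R]_n :=
  [set x | exists y, Omega (row_mx x y)].

Definition BP_feasible : set ('rV[R]_n * 'rV[R]_m) :=
  [set xy | Omega (row_mx xy.1 xy.2) /\ lower_solutions xy.1 xy.2].

Definition BP_objective (xy : 'rV[R]_n * 'rV[R]_m) : R := F (row_mx xy.1 xy.2).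

Definition lagrangian (x : 'rV[R]_n) (z : 'rV[R]_m) (u : 'rV[R]_p)
    (v : 'rV[R]_q) : R :=
  f (row_mx x z) + dotv u (g (row_mx x z)) + dotv v (h (row_mx x z)).

Definition MD_feasible (x : 'rV[R]_n) : set ('rV[R]_m * 'rV[R]_p * 'rV[R]_q) :=
  [set zuv | let: (z, u, v) := zuv in
    [/\ grad (fun z' => lagrangian x z' u v) z = 0,
        0 <= dotv u (g (row_mx x z)) + dotv v (h (row_mx x z)) &
        forall i, 0 <= u 0 i]].

Definition weak_MW_duality (x : 'rV[R]_n) : Prop :=
  forall y' z' u' v', lower_feasible x y' -> MD_feasible x (z', u', v') ->
    f (row_mx x z') <= f (row_mx x y').

(* [row_mx x] is the partial map z |-> (x, z).  As derivatives act on row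
   vectors from the right, the columns of the Jacobian ['J] are the gradients
   of the components. *)
Definition MDP_feasible :
    set ('rV[R]_n * 'rV[R]_m * 'rV[R]_m * 'rV[R]_p * 'rV[R]_q) :=
  [set w | let: (x, y, z, u, v) := w in
    [/\ Omega (row_mx x y),
        (forall i, g (row_mx x y) 0 i <= 0) /\ h (row_mx x y) = 0,
        f (row_mx x y) - f (row_mx x z) <= 0 /\
          0 <= dotv u (g (row_mx x z)) + dotv v (h (row_mx x z)),
        grad (f \o row_mx x) z + u *m ('J (g \o row_mx x) z)^T
          + v *m ('J (h \o row_mx x) z)^T = 0 &
        forall i, 0 <= u 0 i]].

Definition MDP_objective
    (w : 'rV[R]_n * 'rV[R]_m * 'rV[R]_m * 'rV[R]_p * 'rV[R]_q) : R :=
  let: (x, y, z, u, v) := w in F (row_mx x y).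

Definition Lambda (x : 'rV[R]_n) (y z : 'rV[R]_m) : set ('rV[R]_p * 'rV[R]_q) :=
  [set uv | let: (u, v) := uv in
    [/\ f (row_mx x y) - f (row_mx x z) <= 0,
        grad (fun z' => lagrangian x z' u v) z = 0,
        0 <= dotv u (g (row_mx x z)) + dotv v (h (row_mx x z)) &
        forall i, 0 <= u 0 i]].

Definition grad_y {l : nat} (c : 'rV[R]_(n + m) -> 'rV[R]_l) (x : 'rV[R]_n)
    (y : 'rV[R]_m) (j : 'I_l) : 'rV[R]_m :=
  grad (fun y' => c (row_mx x y') 0 j) y.

Definition MFCQ (x : 'rV[R]_n) (y : 'rV[R]_m) : Prop :=
  free [seq grad_y h x y j | j <- enum 'I_q] /\
  exists d : 'rV[R]_m,
    (forall i, g (row_mx x y) 0 i = 0 -> dotv (grad_y g x y i) d < 0) /\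
    (forall j, dotv (grad_y h x y j) d = 0).

End Bilevel.

(* Main.v *)
Require Import Defs.
From HB Require Import structures.
From mathcomp Require Import all_boot all_order all_algebra.
From mathcomp Require Import all_classical all_reals all_analysis.
From mathcomp Require Import ring lra.

Import Order.TTheory GRing.Theory Num.Theory.
Import numFieldNormedType.Exports.

Local Open Scope classical_set_scope.
Local Open Scope ring_scope.

(* A locally better feasible point of (BP) near (xbar, ybar) solves its lower-level
   problem, so by MFCQ it has KKT multipliers, and (x, y, y, u, v) is then feasible
   for (MDP).  Along an ultrafilter of such points the multipliers converge: if the
   normalised multipliers lost the weight of the objective gradient in the limit,
   they would contradict the dual form of MFCQ at (xbar, ybar), which is a lower-level
   solution by weak duality.  The limit lies in Lambda(xbar, ybar, ybar), and local
   optimality in (MDP) there is violated.  The KKT theorem follows from the same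
   compactness argument applied to minimisers of quadratic penalty functions. *)

(** * Limits along ultrafilters and of row vectors *)

Section Filters.
Context {R : realType}.

(** Compactness gives a cluster point [l]. An ultrafilter contains the preimage of each
    neighbourhood [B] of [l] or of its complement, and the latter cannot cluster at [l]; so [l] is a
    limit. *)
Lemma ultra_cvg_compact {T : Type} {V : topologicalType} {U : set_system T}
    {f : T -> V} {K : set V} :
  UltraFilter U -> compact K -> U (f @^-1` K) ->
  exists2 l, K l & f @ U --> l.
Proof.
move=> UU Kc UK; have UP : ProperFilter U by exact: ultra_proper.
have [l [Kl lU]] := Kc (f @ U) _ UK.
exists l => // B Bl; case: (in_ultra_setVsetC (f @^-1` B) UU) => // UC.
by have [z [/= nBz /nBz]] := lU (~` B) B UC Bl.
Qed.

Lemma ultra_cvg_bounded {T : Type} {U : set_system T} {f : T -> R} {C : R} :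
  UltraFilter U -> (\forall t \near U, `|f t| <= C) -> exists l : R, f @ U --> l.
Proof.
move=> UU fC; have UP : ProperFilter U by exact: ultra_proper.
have [] := @ultra_cvg_compact _ _ U f _ UU (@segment_compact R (- C) C);
  last by move=> l; exists l.
by apply: filterS fC => t; rewrite /= in_itv /= ler_norml.
Qed.

Lemma cvg_rV {T : Type} (U : set_system T) (k : nat) (f : T -> 'rV[R]_k)
    (l : 'rV[R]_k) :
  Filter U -> (forall i, (fun t => f t 0 i) @ U --> l 0 i) -> f @ U --> l.
Proof.
move=> UF fl.
have fE : f = fun t => \sum_i f t 0 i *: delta_mx 0 i.
  by apply/funext => t; exact: row_sum_delta.
rewrite fE (row_sum_delta l); apply: cvg_big => [|i _]; first exact: add_continuous.
by apply: cvgZr_tmp; exact: fl.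
Qed.

Lemma cvg_rV_coord {T : Type} {U : set_system T} {UF : Filter U} {k : nat}
    {f : T -> 'rV[R]_k} {l : 'rV[R]_k} i :
  f @ U --> l -> (fun t => f t 0 i) @ U --> l 0 i.
Proof.
move=> fl.
exact: (@continuous_cvg _ _ _ U UF f (fun M : 'rV[R]_k => M 0 i) l
  (@coord_continuous _ _ _ _ _ _) fl).
Qed.

Lemma cvg_sumr {T : Type} (V : normedModType R) (U : set_system T) (k : nat)
    (f : 'I_k -> T -> V) (l : 'I_k -> V) :
  Filter U -> (forall i, f i @ U --> l i) ->
  (fun t => \sum_i f i t) @ U --> \sum_i l i.
Proof. by move=> UF fl; apply: cvg_big => // ; exact: add_continuous. Qed.

Lemma cvg_row_mx {T : Type} (U : set_system T) (k l : nat)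
    (f : T -> 'rV[R]_k) (g : T -> 'rV[R]_l) (a : 'rV[R]_k) (b : 'rV[R]_l) : Filter U ->
  f @ U --> a -> g @ U --> b -> (fun t => row_mx (f t) (g t)) @ U --> row_mx a b.
Proof.
move=> UF fa gb; apply: cvg_rV => i; rewrite mxE.
under eq_fun do rewrite mxE.
by case: (fintype.split i) => j; exact: cvg_rV_coord.
Qed.

End Filters.

(** Positive linear independence, the dual form of MFCQ when [I] is the set of active inequalities
    and [G], [H] are the constraint gradients. *)
Definition positively_independent {R : realType} {m p q : nat} (I : pred 'I_p)
    (G : 'I_p -> 'rV[R]_m) (H : 'I_q -> 'rV[R]_m) : Prop :=
  forall (u : 'I_p -> R) (v : 'I_q -> R),
    (forall i, 0 <= u i) -> (forall i, ~~ I i -> u i = 0) ->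
    \sum_i u i *: G i + \sum_j v j *: H j = 0 ->
    (forall i, u i = 0) /\ (forall j, v j = 0).

(** Dividing by [N], one plus the l1-norms of [u] and [v], makes all weights bounded, hence
    convergent along [U]. Positive independence keeps the limit of the inverse of [N] away from 0,
    so [u] and [v] themselves converge. *)
Lemma multipliers_cvg {R : realType} {T : Type} {U : set_system T} {m p q : nat}
    (I : pred 'I_p)
    (a : T -> 'rV[R]_m) (G : 'I_p -> T -> 'rV[R]_m)
    (H : 'I_q -> T -> 'rV[R]_m) (a0 : 'rV[R]_m) (G0 : 'I_p -> 'rV[R]_m)
    (H0 : 'I_q -> 'rV[R]_m)
    (u : T -> 'rV[R]_p) (v : T -> 'rV[R]_q) :
  UltraFilter U ->
  a @ U --> a0 -> (forall i, G i @ U --> G0 i) -> (forall j, H j @ U --> H0 j) ->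
  (forall i, \forall t \near U, 0 <= u t 0 i) ->
  (forall i, ~~ I i -> \forall t \near U, u t 0 i = 0) ->
  (fun t => a t + \sum_i u t 0 i *: G i t + \sum_j v t 0 j *: H j t) @ U
    --> (0 : 'rV[R]_m) ->
  positively_independent I G0 H0 ->
  exists (u0 : 'rV[R]_p) (v0 : 'rV[R]_q),
    [/\ u @ U --> u0, v @ U --> v0, forall i, 0 <= u0 0 i,
    forall i, ~~ I i -> u0 0 i = 0 &
    a0 + \sum_i u0 0 i *: G0 i + \sum_j v0 0 j *: H0 j = 0].
Proof.
move=> UU aa0 GG0 HH0 u_ge0 u_off res indep; have UP : ProperFilter U by exact: ultra_proper.
pose N t := 1 + \sum_i `|u t 0 i| + \sum_j `|v t 0 j|.
have N1 t : 1 <= N t.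
  by rewrite /N -addrA lerDl addr_ge0 // sumr_ge0.
have N0 t : 0 < N t by rewrite (lt_le_trans _ (N1 t)).
have uN i t : `|u t 0 i / N t| <= 1.
  rewrite normrM normfV (gtr0_norm (N0 t)) ler_pdivrMr // mul1r /N (bigD1 i) //=.
  rewrite -!addrA [leRHS]addrCA lerDl.
  by rewrite !addr_ge0 // sumr_ge0.
have vN j t : `|v t 0 j / N t| <= 1.
  rewrite normrM normfV (gtr0_norm (N0 t)) ler_pdivrMr // mul1r /N (bigD1 j (P := predT)) //=.
  by rewrite [leRHS]addrCA lerDl !addr_ge0 // sumr_ge0.
have lN t : `|(N t)^-1| <= 1.
  by rewrite normfV (gtr0_norm (N0 t)) invf_le1.
have [l0 ll0] := ultra_cvg_bounded UU (filterE _ lN).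
have [u0 uu0] := choice (fun i => ultra_cvg_bounded UU (filterE _ (uN i))).
have [v0 vv0] := choice (fun j => ultra_cvg_bounded UU (filterE _ (vN j))).
have u0_ge0 i : 0 <= u0 i.
  apply: (cvgr_to_ge (uu0 i)); apply: filterS (u_ge0 i) => t ut.
  by rewrite divr_ge0 // ltW.
have u0_off i : ~~ I i -> u0 i = 0.
  move=> Ii; apply: (norm_cvg_unique (uu0 i)); apply: cvg_near_cst.
  by apply: filterS (u_off i Ii) => t ->; rewrite mul0r.
(* The residual divided by [N] still tends to 0, so the normalised limits satisfy the stationarity
   equation with weight [l0] on [a0]. *)
have eq0 : l0 *: a0 + \sum_i u0 i *: G0 i + \sum_j v0 j *: H0 j = 0.
  have lim1 : (N t)^-1 *: (a t + \sum_i u t 0 i *: G i t + \sum_j v t 0 j *: H j t)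
      @[t --> U] --> l0 *: (0 : 'rV[R]_m) by exact: cvgZ.
  rewrite scaler0 in lim1; apply: (norm_cvg_unique _ lim1) => /=.
  under eq_fun do rewrite !scalerDr !scaler_sumr.
  apply: cvgD; [apply: cvgD; first exact: cvgZ|]; apply: cvg_sumr => i;
    under eq_fun do rewrite scalerA mulrC; exact: cvgZ.
(* For every [t] the normalised weights have absolute sum 1; this survives in the limit and excludes
   that all limits vanish. *)
have sum1 : l0 + \sum_i `|u0 i| + \sum_j `|v0 j| = 1.
  have lim1 : (N t)^-1 + \sum_i `|u t 0 i / N t| + \sum_j `|v t 0 j / N t|
      @[t --> U] --> l0 + \sum_i `|u0 i| + \sum_j `|v0 j|.
    apply: cvgD; [apply: cvgD => //|];
      apply: cvg_sumr => i; exact: cvg_norm.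
  apply: (norm_cvg_unique lim1); apply: cvg_near_cst; apply: filterE => t.
  have NN x : `|x / N t| = `|x| / N t by rewrite normrM normfV (gtr0_norm (N0 t)).
  under eq_bigr do rewrite NN; under [X in _ + X]eq_bigr do rewrite NN.
  rewrite -!mulr_suml -[X in X + _ + _]mul1r -!mulrDl.
  exact: (divff (lt0r_neq0 (N0 t))).
(* With [l0 = 0], positive independence would annihilate every remaining weight, against [sum1]. *)
have l0_neq0 : l0 != 0.
  apply/eqP => l00; move: eq0 sum1; rewrite l00 scale0r !add0r => /(indep u0 v0)-[] // uz vz.
  under eq_bigr do rewrite uz normr0; under [X in _ + X]eq_bigr do rewrite vz normr0.
  by rewrite !big1 // addr0 => /esym/eqP; rewrite oner_eq0.
have l0_gt0 : 0 < l0.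
  rewrite lt_def l0_neq0 /=; apply: (cvgr_to_ge ll0); apply: filterE => t.
  by rewrite invr_ge0 ltW.
have unN (x : T -> R) (x0 : R) : (fun t => x t / N t) @ U --> x0 -> x @ U --> x0 / l0.
  move=> xx0; have -> : x = fun t => (x t / N t) * (N t)^-1^-1.
    by apply/funext => t; rewrite invrK divfK // gt_eqF.
  by apply: cvgM => //; exact: cvgV.
exists (\row_i (u0 i / l0)), (\row_j (v0 j / l0)); split.
- by apply: cvg_rV => i; rewrite mxE; exact: unN.
- by apply: cvg_rV => i; rewrite mxE; exact: unN.
- by move=> i; rewrite mxE divr_ge0 // ltW.
- by move=> i /u0_off; rewrite mxE => ->; rewrite mul0r.
- apply: (scalerI l0_neq0); rewrite scaler0 -[RHS]eq0 !scalerDr !scaler_sumr.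
  congr (_ + _ + _); apply: eq_bigr => i _; by rewrite mxE scalerA mulrC divfK.
Qed.

(** * First-order condition at a local minimum, and positive parts *)

Section Calculus.
Context {R : realType}.

(** The difference quotient is nonpositive for [h < 0] and nonnegative for [h > 0], and both
    one-sided limits equal the derivative. *)
Lemma derive_local_min {V : normedModType R} {Q : V -> R} {y v : V} :
  derivable Q y v -> (\forall z \near y, Q y <= Q z) -> 'D_v Q y = 0.
Proof.
move=> dQ ymin; apply: le_anti; apply/andP.
have line0 : (fun h : R => h *: v + y) @ (0 : R) --> y.
  rewrite -[X in _ --> X]add0r -(scale0r v); apply: cvgD; last exact: cvg_cst.
  by apply: cvgZr_tmp; exact: cvg_id.
have hmin : \forall h \near (0 : R), Q y <= Q (h *: v + y) by exact: line0 ymin.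
have quot : (fun h => h^-1 *: ((Q \o shift y) (h *: v) - Q y)) @ (0 : R)^' --> 'D_v Q y.
  exact: dQ.
split.
- apply: (cvgr_to_le (cvg_dnbhs_at_left quot)); near=> h.
  rewrite /= nmulr_rle0; first by rewrite subr_ge0; near: h; exact: cvg_within.
  by rewrite invr_lt0.
- apply: (cvgr_to_ge (cvg_dnbhs_at_right quot)); near=> h.
  rewrite /= pmulr_rge0; first by rewrite subr_ge0; near: h; exact: cvg_within.
  by rewrite invr_gt0.
Unshelve. all: by end_near. Qed.

(** In [s], the right side is a smooth majorant that touches the squared positive part at [s = t]:
    it is the square of [s] for [0 <= t], and of [s - t > s] for [t < 0]. *)
Lemma maxr_sqr_le (t s : R) : Num.max s 0 ^+ 2 <= (Num.max t 0 + (s - t)) ^+ 2.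
Proof.
have [s0|s0] := ltP s 0; first by rewrite expr0n /= sqr_ge0.
by have [t0|t0] := ltP t 0; nra.
Qed.

Lemma cvg_maxr0 {T : Type} (U : set_system T) (f : T -> R) (l : R) : Filter U ->
  f @ U --> l -> (fun t => Num.max (f t) 0) @ U --> Num.max l 0.
Proof.
move=> UF fl.
have E (x : R) : Num.max x 0 = (x + `|x|) / 2.
  by have [x0|x0] := ltP x 0; [rewrite ltr0_norm // subrr mul0r|rewrite ger0_norm //; lra].
rewrite E; under eq_fun do rewrite E.
by apply: cvgMr_tmp; apply: cvgD => //; exact: cvg_norm.
Qed.

End Calculus.

(** * KKT conditions by quadratic penalties *)

Section Penalty.
Context {R : realType} {m p q : nat}.
Variables (phi : 'rV[R]_m -> R) (gam : 'I_p -> 'rV[R]_m -> R)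
  (eta : 'I_q -> 'rV[R]_m -> R) (y0 : 'rV[R]_m).

Definition infeasibility (y : 'rV[R]_m) : R :=
  \sum_i Num.max (gam i y) 0 ^+ 2 + \sum_j eta j y ^+ 2.

(** This term of the penalty forces the penalty minimisers to converge to [y0] even when [phi] has
    other constrained minimisers. *)
Definition dist_sqr (y : 'rV[R]_m) : R := \sum_c (y 0 c - y0 0 c) ^+ 2.

Definition penalty (k : R) (y : 'rV[R]_m) : R :=
  phi y + k * infeasibility y + dist_sqr y.

Lemma is_derive_coord (y v : 'rV[R]_m) (c : 'I_m) :
  is_derive y v (fun z : 'rV[R]_m => z 0 c) (v 0 c).
Proof.
have dc := @differentiable_coord R _ _ y 0 c.
apply: DeriveDef; first exact: diff_derivable.
rewrite /derive; apply: cvg_lim => //.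
apply: (@cvg_trans _ (cst (v 0 c) @ (0 : R)^')); last exact: cvg_cst.
apply: near_eq_cvg; near=> h.
rewrite /= !mxE addrK /GRing.scale /= mulKf //.
by near: h; exact: nbhs_dnbhs_neq.
Unshelve. all: by end_near. Qed.

(** The coefficients of the constraint gradients are the approximate multipliers, and the right side
    is a residual that vanishes as [y] tends to [y0]. *)
Lemma penalty_stationary (k : R) (y : 'rV[R]_m) :
  0 <= k -> differentiable phi y ->
  (forall i, differentiable (gam i) y) -> (forall j, differentiable (eta j) y) ->
  (\forall z \near y, penalty k y <= penalty k z) ->
  grad phi y + \sum_i (2 * k * Num.max (gam i y) 0) *: grad (gam i) y
    + \sum_j (2 * k * eta j y) *: grad (eta j) y = - (2 *: (y - y0)).
Proof.
move=> k0 dphi dgam deta ymin.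
(* The squared positive parts are replaced by their differentiable majorants of
   [maxr_sqr_le], which agree with them at [y]; hence [y] also minimises [Q]. *)
pose Q : 'rV[R]_m -> R := phi
  + k *: (\sum_i (cst (Num.max (gam i y) 0 - gam i y) + gam i) ^+ 2 + \sum_j eta j ^+ 2)
  + \sum_c ((fun z : 'rV[R]_m => z 0 c) - cst (y0 0 c)) ^+ 2.
have QE z : Q z = phi z
  + k * (\sum_i (Num.max (gam i y) 0 + (gam i z - gam i y)) ^+ 2 + \sum_j eta j z ^+ 2)
  + \sum_c (z 0 c - y0 0 c) ^+ 2.
  rewrite /Q !fctE /= !fct_sumE; congr (_ + _ * (_ + _) + _).
  by apply: eq_bigr => i _; rewrite exprfctE /= fctE addrAC addrA.
have Qmin : \forall z \near y, Q y <= Q z.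
  apply: filterS ymin => z; rewrite (_ : Q y = penalty k y); last first.
    rewrite QE; congr (_ + _ * (_ + _) + _).
    by apply: eq_bigr => i _; rewrite subrr addr0.
  move=> /le_trans; apply; rewrite QE lerD2r lerD2l ler_wpM2l // lerD2r.
  by apply: ler_sum => i _; exact: maxr_sqr_le.
apply/rowP => c; set e : 'rV[R]_m := delta_mx 0 c.
have ephi : is_derive y e phi ('D_e phi y) by exact/derivableP/diff_derivable.
have egam i : is_derive y e (gam i) ('D_e (gam i) y) by exact/derivableP/diff_derivable.
have eeta i : is_derive y e (eta i) ('D_e (eta i) y) by exact/derivableP/diff_derivable.
have ecoord := is_derive_coord y e.
have dgam2 i := is_deriveX 2 (is_deriveD (is_derive_cst (Num.max (gam i y) 0 - gam i y) y e)
  (egam i)).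
have deta2 j := is_deriveX 2 (eeta j).
have dcoord2 i := is_deriveX 2 (is_deriveB (ecoord i) (is_derive_cst (y0 0 i) y e)).
have dQ := is_deriveD (is_deriveD ephi (is_deriveZ k (is_deriveD (is_derive_sum dgam2)
  (is_derive_sum deta2)))) (is_derive_sum dcoord2).
have := derive_local_min (@ex_derive _ _ _ _ _ _ _ dQ) Qmin.
(* Among the squares in the distance term, only the one of index [c] varies in the direction [e]. *)
rewrite (@derive_val _ _ _ _ _ _ _ dQ) /= (bigD1 c) //= [X in _ + (_ + X)]big1; last first.
  by move=> i ic; rewrite /e mxE eqxx (negbTE ic) subr0 scaler0.
rewrite addr0 /e mxE !eqxx subr0 !mxE !summxE => /eqP; rewrite addr_eq0 => /eqP E.
rewrite /GRing.scale /= !mulr1 in E *; rewrite -[RHS]E mulrDr !mulr_sumr addrA.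
congr (_ + _ + _); apply: eq_bigr => i _; rewrite !mxE.
  by rewrite expr1 add0r !fctE subrK; ring.
by rewrite expr1; ring.
Qed.

Lemma infeasibility_ge0 (y : 'rV[R]_m) : 0 <= infeasibility y.
Proof. by rewrite addr_ge0 // sumr_ge0 // => i _; rewrite sqr_ge0. Qed.

Lemma infeasibility_eq0 {y : 'rV[R]_m} : infeasibility y <= 0 ->
  (forall i, gam i y <= 0) /\ (forall j, eta j y = 0).
Proof.
have ge0 (l : nat) (s : 'I_l -> R) : 0 <= \sum_i s i ^+ 2.
  by rewrite sumr_ge0 // => i _; rewrite sqr_ge0.
move=> inf_le0; have : infeasibility y == 0 by rewrite eq_le inf_le0 infeasibility_ge0.
rewrite paddr_eq0 // => /andP[/eqP/psumr_eq0P g0 /eqP/psumr_eq0P h0].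
split=> i.
  have /eqP := g0 (fun i _ => sqr_ge0 _) i isT.
  by rewrite sqrf_eq0 => /eqP {1}<-; rewrite le_max lexx.
by have /eqP := h0 (fun j _ => sqr_ge0 _) i isT; rewrite sqrf_eq0 => /eqP.
Qed.

Lemma cvg_infeasibility {T : Type} (U : set_system T) (f : T -> 'rV[R]_m) (l : 'rV[R]_m) :
  Filter U -> (forall i, continuous (gam i)) -> (forall j, continuous (eta j)) ->
  f @ U --> l -> infeasibility (f t) @[t --> U] --> infeasibility l.
Proof.
move=> UF cgam ceta fl; apply: cvgD; apply: cvg_sumr => i.
  apply: (@cvgM _ _ U _ (fun t => Num.max (gam i (f t)) 0) (fun t => Num.max (gam i (f t)) 0));
  apply: cvg_maxr0; exact: (continuous_cvg UF (cgam i l) fl).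
by apply: (@cvgM _ _ U _ (fun t => eta i (f t)) (fun t => eta i (f t)));
  exact: (continuous_cvg UF (ceta i l) fl).
Qed.

Lemma cvg_dist_sqr {T : Type} (U : set_system T) (f : T -> 'rV[R]_m) (l : 'rV[R]_m) :
  Filter U -> f @ U --> l ->
  dist_sqr (f t) @[t --> U] --> dist_sqr l.
Proof.
move=> UF fl; apply: cvg_sumr => c.
have fc : (fun t => f t 0 c - y0 0 c) @ U --> l 0 c - y0 0 c.
  exact: (cvgB (cvg_rV_coord c fl) (cvg_cst _)).
exact: (cvgM fc fc).
Qed.

Lemma continuous_penalty k : continuous phi ->
  (forall i, continuous (gam i)) -> (forall j, continuous (eta j)) ->
  continuous (penalty k).
Proof.
move=> cphi cgam ceta y.
have cinf : infeasibility @ y --> infeasibility y.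
  exact: (@cvg_infeasibility _ (nbhs y) id y _ cgam ceta cvg_id).
have cdist : dist_sqr @ y --> dist_sqr y.
  exact: (@cvg_dist_sqr _ (nbhs y) id y _ cvg_id).
rewrite /continuous_at /penalty.
apply: (@cvgD _ _ _ (nbhs y) _ (fun y => phi y + k * infeasibility y)) => //.
apply: (@cvgD _ _ _ (nbhs y) _ phi (fun y => k * infeasibility y)); first exact: cphi.
exact: cvgMl_tmp.
Qed.

Lemma penalty_at_feasible k y : (forall i, gam i y <= 0) -> (forall j, eta j y = 0) ->
  penalty k y = phi y + dist_sqr y.
Proof.
move=> gy hy; rewrite /penalty /infeasibility !big1 ?addr0 ?mulr0 ?addr0 // => i _.
  by rewrite hy expr0n.
by rewrite max_r // expr0n.
Qed.

Hypotheses (phiC1 : C1 phi) (gamC1 : forall i, C1 (gam i)) (etaC1 : forall j, C1 (eta j)).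
Hypotheses (y0_ineq : forall i, gam i y0 <= 0) (y0_eq : forall j, eta j y0 = 0).
Hypothesis y0_min : forall y, (forall i, gam i y <= 0) -> (forall j, eta j y = 0) ->
  phi y0 <= phi y.

(** Minimisers over a compact box around [y0] have a limit [l] along an ultrafilter. Comparison with
    [y0] shows that [l] is feasible and then that [l = y0], the centre of the box, so the box
    constraint is eventually inactive. *)
Lemma penalty_minimizers_cvg : exists (U : set_system nat) (y : nat -> 'rV[R]_m),
  [/\ UltraFilter U, y @ U --> y0 &
  \forall k \near U, \forall z \near y k, penalty k.+1%:R (y k) <= penalty k.+1%:R z].
Proof.
have C1_continuous (f : 'rV[R]_m -> R) : C1 f -> continuous f.
  by move=> [df _] z; exact: differentiable_continuous.
have cphi := C1_continuous _ phiC1.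
have cgam i := C1_continuous _ (gamC1 i).
have ceta j := C1_continuous _ (etaC1 j).
pose A : set 'rV[R]_m := [set v | forall c, `[y0 0 c - 1, y0 0 c + 1]%classic (v 0 c)].
have Ac : compact A.
  exact: (@rV_compact R m (fun c => `[y0 0 c - 1, y0 0 c + 1]%classic)
    (fun c => @segment_compact _ _ _)).
have Ay0 : A y0 by move=> c; rewrite /= in_itv /= gerBl lerDl ler01.
have [y ymin] : exists y : nat -> 'rV[R]_m, forall k, A (y k) /\
    forall z, A z -> penalty k.+1%:R (y k) <= penalty k.+1%:R z.
  suff /choice[y Hy] : forall k : nat, exists y, A y /\
    forall z, A z -> penalty k.+1%:R y <= penalty k.+1%:R z by exists y.
  move=> k; have [|c cA cmin] := @EVT_min_rV _ _ (penalty k.+1%:R) A (ex_intro _ y0 Ay0) Ac.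
  - by apply: continuous_subspaceT; exact: continuous_penalty.
  - by exists c; split; [exact/set_mem|move=> z Az; exact/cmin/mem_set].
have [U [UU ooU]] := @ultraFilterLemma nat \oo _.
have UP : ProperFilter U by exact: ultra_proper.
have [l Al yl] := ultra_cvg_compact UU Ac (filterE _ (fun k => (ymin k).1)).
have phiyl : phi (y k) @[k --> U] --> phi l by exact: continuous_cvg (cphi l) yl.
(* The competitor [y0] is feasible and at distance 0 from itself, so its penalty is [phi y0] for
   every [k]. *)
have le0 k : phi (y k) + k.+1%:R * infeasibility (y k) + dist_sqr (y k) <= phi y0.
  apply: le_trans ((ymin k).2 _ Ay0) _; rewrite penalty_at_feasible //.
  by rewrite [dist_sqr _]big1 ?addr0 // => c _; rewrite subrr expr0n.
have dist_ge0 (z : 'rV[R]_m) : 0 <= dist_sqr z.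
  by rewrite sumr_ge0 // => c _; rewrite sqr_ge0.
have inv0 : (k.+1%:R^-1 : R) @[k --> U] --> (0 : R).
  by move=> B B0; apply: ooU; exact: cvg_harmonic B0.
(* Divide [le0] by the positive parameter [k.+1%:R], drop the distance term and let [k] grow. *)
have linf : infeasibility l <= 0.
  have lim : (phi y0 - phi (y k)) * k.+1%:R^-1 - infeasibility (y k) @[k --> U]
      --> (phi y0 - phi l) * 0 - infeasibility l.
    apply: cvgB; last by apply: cvg_infeasibility.
    exact: (cvgM (cvgB (cvg_cst _) phiyl) inv0).
  rewrite -oppr_ge0 -[leRHS]add0r -(mulr0 (phi y0 - phi l)).
  apply: (cvgr_to_ge lim); apply: filterE => k.
  rewrite mulr0 subr_ge0 ler_pdivlMr ?ltr0Sn // mulrC.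
  by have := le0 k; have := dist_ge0 (y k); lra.
have [lg lh] := infeasibility_eq0 linf.
(* Dropping the penalty term in [le0] bounds [phi l + dist_sqr l] by [phi y0], which is at most
   [phi l] because [l] is feasible. *)
have dist0 : dist_sqr l <= 0.
  have : phi l + dist_sqr l <= phi y0.
    have lim : phi (y k) + dist_sqr (y k) @[k --> U] --> phi l + dist_sqr l.
      exact: (cvgD phiyl (@cvg_dist_sqr _ U y l _ yl)).
    apply: (cvgr_to_le lim).
    apply: filterE => k; apply: le_trans (le0 k).
    by rewrite lerD2r lerDl mulr_ge0 // infeasibility_ge0.
  by have := y0_min _ lg lh; lra.
have ly0 : l = y0.
  apply/rowP => c; apply/eqP; rewrite -subr_eq0 -sqrf_eq0; apply/eqP.
  apply: (psumr_eq0P (P := predT) (fun c _ => sqr_ge0 (l 0 c - y0 0 c))) => //.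
  by apply: le_anti; rewrite dist0 dist_ge0.
exists U, y; rewrite ly0 in yl; split => //.
(* Since the minimisers converge to the centre, they are eventually interior to the box, hence local
   minimisers without the box constraint. *)
have Anbhs : nbhs y0 A.
  suff near_c c : nbhs y0 [set z : 'rV[R]_m | `[y0 0 c - 1, y0 0 c + 1]%classic (z 0 c)].
    exact: filter_forall near_c.
  have coord_cvg : (fun z : 'rV[R]_m => z 0 c) @ y0 --> y0 0 c by exact: coord_continuous.
  have /cvgrPdist_lt/(_ _ ltr01) := coord_cvg.
  by apply: filterS => z; rewrite /= in_itv /= ltr_norml; lra.
have yA : \forall k \near U, nbhs (y k) A by exact: yl _ (nbhs_interior Anbhs).
by apply: filterS yA => k yk; apply: filterS yk => z /(ymin k).2.
Qed.

(** The approximate multipliers read off from stationarity of the penalty converge by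
    [multipliers_cvg], and their limits are KKT multipliers. *)
Lemma kkt :
  positively_independent (fun i => gam i y0 == 0) (fun i => grad (gam i) y0)
    (fun j => grad (eta j) y0) ->
  exists (u : 'rV[R]_p) (v : 'rV[R]_q), [/\ forall i, 0 <= u 0 i,
    forall i, u 0 i * gam i y0 = 0 &
    grad phi y0 + \sum_i u 0 i *: grad (gam i) y0
      + \sum_j v 0 j *: grad (eta j) y0 = 0].
Proof.
move=> indep; have [U [y [UU yy0 ymin]]] := penalty_minimizers_cvg.
have UP : ProperFilter U by exact: ultra_proper.
pose u (k : nat) : 'rV[R]_p := \row_i (2 * k.+1%:R * Num.max (gam i (y k)) 0).
pose v (k : nat) : 'rV[R]_q := \row_j (2 * k.+1%:R * eta j (y k)).
have grad_cvg (f : 'rV[R]_m -> R) : C1 f -> grad f (y k) @[k --> U] --> grad f y0.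
  by move=> [_ cf]; exact: (continuous_cvg UP (cf y0) yy0).
have [] := @multipliers_cvg _ _ U _ _ _ (fun i => gam i y0 == 0)
  (fun k => grad phi (y k)) (fun i k => grad (gam i) (y k))
  (fun j k => grad (eta j) (y k)) _ _ _ u v UU (grad_cvg _ phiC1)
  (fun i => grad_cvg _ (gamC1 i)) (fun j => grad_cvg _ (etaC1 j)) _ _ _ indep.
- by move=> i; apply: filterE => k; rewrite mxE !mulr_ge0 // le_max lexx orbT.
(* An inactive constraint stays negative near [y0], so its positive part, and with it its
   approximate multiplier, is eventually 0. *)
- move=> i gi0; have gi_lt0 : gam i y0 < 0 by rewrite lt_neqAle gi0 y0_ineq.
  have gam_cvg : gam i (y k) @[k --> U] --> gam i y0.
    exact: (continuous_cvg UP (differentiable_continuous ((gamC1 i).1 y0)) yy0).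
  apply: filterS (cvgr_lt _ gam_cvg _ gi_lt0) => k gk.
  by rewrite mxE max_r ?mulr0 // ltW.
- have lim : - (2 *: (y k - y0)) @[k --> U] --> (0 : 'rV[R]_m).
    rewrite -[X in _ --> X](_ : - (2 *: (y0 - y0)) = 0); last by rewrite subrr scaler0 oppr0.
    by apply: cvgN; apply: cvgZl_tmp; apply: cvgB => //; exact: cvg_cst.
  apply: cvg_trans lim; apply: near_eq_cvg; apply: filterS ymin => k ymin.
  rewrite -(@penalty_stationary k.+1%:R) //.
  + by congr (_ + _ + _); apply: eq_bigr => i _; rewrite mxE.
  + by case: phiC1.
  + by move=> i; case: (gamC1 i).
  + by move=> i; case: (etaC1 i).
move=> u0 [v0 [_ _ u0_ge0 u0_off stat]]; exists u0, v0; split => // i.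
by have [->|/u0_off ->] := eqVneq (gam i y0) 0; rewrite ?mulr0 ?mul0r.
Qed.

End Penalty.

(** * Gradients with respect to the second block of variables *)

Section Partial.
Context {R : realType} {n m : nat}.

Lemma grad_partial (f : 'rV[R]_(n + m) -> R) x y :
  grad (f \o row_mx x) y = rsubmx (grad f (row_mx x y)).
Proof.
apply/rowP => i; rewrite !mxE /derive.
suff shiftE (h : R) : row_mx x (h *: 'e_i + y) = h *: 'e_(rshift n i) + row_mx x y.
  by under eq_fun do rewrite /= shiftE.
by rewrite delta_mx_rshift scale_row_mx add_row_mx scaler0 add0r.
Qed.

Lemma differentiable_rV {V : normedModType R} {l : nat} (c : V -> 'rV[R]_l) (y : V) :
  (forall i, differentiable (fun z => c z 0 i) y) -> differentiable c y.
Proof.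
move=> dc; have -> : c = \sum_i (fun z => c z 0 i *: delta_mx 0 i).
  by apply/funext => z; rewrite fct_sumE; exact: row_sum_delta.
by apply: differentiable_sum => i; exact: differentiableZl.
Qed.

Lemma C1_partial (f : 'rV[R]_(n + m) -> R) x : C1 f -> C1 (f \o row_mx x).
Proof.
move=> [df cf]; split=> [y|].
  apply: differentiable_comp => //; apply: differentiable_rV => i.
  have -> : (fun z : 'rV[R]_m => row_mx x z 0 i) =
      match fintype.split i with inl j => cst (x 0 j) | inr j => fun z => z 0 j end.
    by apply/funext => z; rewrite mxE; case: (fintype.split i).
  by case: (fintype.split i) => j; [exact: differentiable_cst|exact: differentiable_coord].
have -> : grad (f \o row_mx x) = fun y => rsubmx (grad f (row_mx x y)).
  by apply/funext => y; exact: grad_partial.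
move=> y.
have row_cvg : row_mx x z @[z --> y] --> row_mx x y.
  exact: (@cvg_row_mx _ _ (nbhs y) _ _ (cst x) id x y _ (cvg_cst _) cvg_id).
have gcvg : grad f (row_mx x z) @[z --> y] --> grad f (row_mx x y).
  exact: (continuous_cvg _ (cf _) row_cvg).
exact: (continuous_cvg _ (@continuous_rsubmx _ _ _ _ _) gcvg).
Qed.

(** Links the matrix form of stationarity in (MDP) to the sums of gradients in the KKT conditions;
    [grad_lagrangian] does the same for the form in [Lambda]. *)
Lemma mulmx_jacobianT {l : nat} (c : 'rV[R]_(n + m) -> 'rV[R]_l) (u : 'rV[R]_l) x y :
  C2_vec c ->
  u *m ('J (c \o row_mx x) y)^T = \sum_i u 0 i *: grad_y c x y i.
Proof.
move=> cC2.
have dc : differentiable (c \o row_mx x) y.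
  by apply: differentiable_rV => i; case: (C1_partial _ x (cC2 i).1) => + _; exact.
apply/rowP => k; rewrite mxE summxE; apply: eq_bigr => i _; rewrite !mxE; congr (_ * _).
have := deriveEjacobian 'e_k dc; rewrite -rowE derive_mx; last exact: diff_derivable.
by move/rowP/(_ i); rewrite !mxE => <-.
Qed.

Lemma grad_lagrangian {p q : nat} (f : 'rV[R]_(n + m) -> R)
    (g : 'rV[R]_(n + m) -> 'rV[R]_p) (h : 'rV[R]_(n + m) -> 'rV[R]_q) x y u v :
  C2 f -> C2_vec g -> C2_vec h ->
  grad (fun z => lagrangian f g h x z u v) y = grad (f \o row_mx x) y
    + \sum_i u 0 i *: grad_y g x y i + \sum_j v 0 j *: grad_y h x y j.
Proof.
move=> fC2 gC2 hC2; apply/rowP => k; rewrite !mxE !summxE.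
have dpart (c : 'rV[R]_(n + m) -> R) : C2 c ->
    is_derive y 'e_k (c \o row_mx x) ('D_('e_k) (c \o row_mx x) y).
  by move=> [cC1 _]; apply/derivableP/diff_derivable; case: (C1_partial _ x cC1) => + _; exact.
have df := dpart _ fC2.
have dg i := dpart _ (gC2 i).
have dh i := dpart _ (hC2 i).
have -> : (fun z => lagrangian f g h x z u v) = (f \o row_mx x)
    + \sum_i u 0 i *: ((fun a => g a 0 i) \o row_mx x)
    + \sum_j v 0 j *: ((fun a => h a 0 j) \o row_mx x).
  by apply/funext => z; rewrite !fctE /= !fct_sumE.
rewrite derive_val; congr (_ + _ + _); apply: eq_bigr => i _; by rewrite !mxE.
Qed.

End Partial.

(** * From MFCQ to its dual form *)

Section ConstraintQualification.
Context {R : realType} {n m p q : nat}.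
Variables (g : 'rV[R]_(n + m) -> 'rV[R]_p) (h : 'rV[R]_(n + m) -> 'rV[R]_q).

Lemma dotv_lincomb {k l : nat} (c : 'I_k -> R) (G : 'I_k -> 'rV[R]_l) (d : 'rV[R]_l) :
  dotv (\sum_i c i *: G i) d = \sum_i c i * dotv (G i) d.
Proof.
rewrite /dotv; under eq_bigr do rewrite summxE mulr_suml.
rewrite exchange_big /=; apply: eq_bigr => i _; rewrite mulr_sumr.
by apply: eq_bigr => j _; rewrite mxE mulrA.
Qed.

(** Pair the vanishing combination with the direction [d] of MFCQ. The equality gradients drop out
    and a sum of nonpositive terms is 0, so each term is 0 and [u] vanishes; linear independence
    then gives [v = 0]. *)
Lemma MFCQ_positively_independent x y : MFCQ g h x y ->
  positively_independent (fun i => g (row_mx x y) 0 i == 0) (grad_y g x y) (grad_y h x y).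
Proof.
move=> [freeh [d [gd hd]]] u v u_ge0 u_off comb.
have dot_comb : \sum_i u i * dotv (grad_y g x y i) d = 0.
  have : dotv (\sum_i u i *: grad_y g x y i + \sum_j v j *: grad_y h x y j) d = 0.
    by rewrite comb /dotv big1 // => i _; rewrite mxE mul0r.
  rewrite (_ : dotv _ _ = dotv (\sum_i u i *: grad_y g x y i) d
    + dotv (\sum_j v j *: grad_y h x y j) d); last first.
    by rewrite /dotv -big_split; apply: eq_bigr => i _; rewrite mxE mulrDl.
  by rewrite !dotv_lincomb [X in _ + X]big1 ?addr0 // => j _; rewrite hd mulr0.
have u0 i : u i = 0.
  have [/eqP gi0|/u_off //] := boolP (g (row_mx x y) 0 i == 0).
  have nonpos j : 0 <= - (u j * dotv (grad_y g x y j) d).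
    rewrite oppr_ge0; have [/eqP /gd/ltW gj|/u_off ->] := boolP (g (row_mx x y) 0 j == 0).
      exact: mulr_ge0_le0.
    by rewrite mul0r.
  have /psumr_eq0P : \sum_j - (u j * dotv (grad_y g x y j) d) = 0.
    by rewrite sumrN dot_comb oppr0.
  move=> /(_ (fun j _ => nonpos j) i isT)/eqP.
  by rewrite oppr_eq0 mulf_eq0 (lt_eqF (gd i gi0)) orbF => /eqP.
split=> // j.
have size_grads : size [seq grad_y h x y j | j <- enum 'I_q] == q.
  by rewrite size_map size_enum_ord.
have /freeP freeht : free (Tuple size_grads) by [].
apply: freeht; rewrite -[RHS]comb [X in _ = X + _]big1 ?add0r => [|i _];
  last by rewrite u0 scale0r.
apply: eq_bigr => i _; congr (_ *: _).
by rewrite /= (nth_map i) ?size_enum_ord // nth_ord_enum.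
Qed.

End ConstraintQualification.

(** * Multipliers at lower-level solutions *)

Definition KKT_multipliers {R : realType} {n m p q : nat} (f : 'rV[R]_(n + m) -> R)
    (g : 'rV[R]_(n + m) -> 'rV[R]_p) (h : 'rV[R]_(n + m) -> 'rV[R]_q) x y
    (u : 'rV[R]_p) (v : 'rV[R]_q) : Prop :=
  [/\ forall i, 0 <= u 0 i,
    forall i, u 0 i * g (row_mx x y) 0 i = 0 &
    grad (f \o row_mx x) y + \sum_i u 0 i *: grad_y g x y i
      + \sum_j v 0 j *: grad_y h x y j = 0].

Lemma lower_kkt {R : realType} {n m p q : nat} (f : 'rV[R]_(n + m) -> R)
    (g : 'rV[R]_(n + m) -> 'rV[R]_p) (h : 'rV[R]_(n + m) -> 'rV[R]_q) x y :
  C2 f -> C2_vec g -> C2_vec h -> lower_solutions f g h x y -> MFCQ g h x y ->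
  exists uv, KKT_multipliers f g h x y uv.1 uv.2.
Proof.
move=> fC2 gC2 hC2 [[gy hy] ymin] mfcq.
have [] := @kkt _ _ _ _ (f \o row_mx x) (fun i z => g (row_mx x z) 0 i)
  (fun j z => h (row_mx x z) 0 j) y.
- exact: C1_partial fC2.1.
- by move=> i; exact: C1_partial (gC2 i).1.
- by move=> j; exact: C1_partial (hC2 j).1.
- exact: gy.
- by move=> j; rewrite hy mxE.
- by move=> z gz hz; apply: ymin; split => //; apply/rowP => j; rewrite hz mxE.
- exact: MFCQ_positively_independent.
by move=> u [v uvP]; exists (u, v).
Qed.

(** * Local optimality in the bilevel program *)

Theorem theorem3p4 (R : realType) (n m p q : nat)
    (Omega : set 'rV[R]_(n + m)) (F f : 'rV[R]_(n + m) -> R)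
    (g : 'rV[R]_(n + m) -> 'rV[R]_p) (h : 'rV[R]_(n + m) -> 'rV[R]_q)
    (F_C1 : C1 F) (f_C2 : C2 f) (g_C2 : C2_vec g) (h_C2 : C2_vec h)
    (lower_solvable : forall x, upper_domain Omega x ->
       lower_solutions f g h x !=set0)
    (xbar : 'rV[R]_n) (ybar : 'rV[R]_m)
    (Lambda_neq0 : Lambda f g h xbar ybar ybar !=set0)
    (MDP_optimal : forall ubar vbar, Lambda f g h xbar ybar ybar (ubar, vbar) ->
       locally_optimal (MDP_feasible Omega f g h) (MDP_objective F)
         (xbar, ybar, ybar, ubar, vbar))
    (weak_duality : weak_MW_duality f g h xbar)
    (near_MFCQ : \forall xy \near (xbar, ybar),
       lower_solutions f g h xy.1 xy.2 -> MFCQ g h xy.1 xy.2) :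
  locally_optimal (BP_feasible Omega f g h) (BP_objective F) (xbar, ybar).
Proof.
have barP u v : Lambda f g h xbar ybar ybar (u, v) ->
    MDP_feasible Omega f g h (xbar, ybar, ybar, u, v).
  by move=> /MDP_optimal[].
(* For any [(u, v)] in [Lambda], the triple [(ybar, u, v)] is dual feasible, so weak duality makes
   [f] at [(xbar, ybar)] a lower bound over the lower-level feasible set. *)
have bar_feasible : BP_feasible Omega f g h (xbar, ybar).
  case: Lambda_neq0 => -[u v] Luv.
  have [Oxy gh_feas _ _ _] := barP _ _ Luv.
  case: Luv => _ gradL compl u_ge0.
  by split=> //; split=> // y' /weak_duality; apply; split; eassumption.
split=> //; apply: contrapT => not_opt.
pose bad : set ('rV[R]_n * 'rV[R]_m) := [set xy | BP_feasible Omega f g h xy /\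
  BP_objective F xy < BP_objective F (xbar, ybar)].
(* If this filter were improper, some neighbourhood would contain no bad point, which is local
   optimality. *)
have badP : ProperFilter (within bad (nbhs (xbar, ybar))).
  split; last exact: within_filter.
  rewrite /within /= => notbad; apply: not_opt.
  apply: filterS notbad => xy nxy feas; rewrite leNgt; apply/negP => lt.
  exact: nxy.
have [U [UU subU]] := ultraFilterLemma badP.
have UP : ProperFilter U by exact: ultra_proper.
have Ubar : U --> (xbar, ybar) by move=> B Bbar; apply: subU; exact: cvg_within Bbar.
have Ubad : U bad by apply: subU; exact: withinT.
have Ux : xy.1 @[xy --> U] --> xbar.
  by move=> B xB; apply: (Ubar (fst @^-1` B)); exact: cvg_fst.
have Uy : xy.2 @[xy --> U] --> ybar.
  by move=> B yB; apply: (Ubar (snd @^-1` B)); exact: cvg_snd.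
have Uxy : row_mx xy.1 xy.2 @[xy --> U] --> row_mx xbar ybar by exact: cvg_row_mx.
have kkt_ex xy : exists uv, lower_solutions f g h xy.1 xy.2 -> MFCQ g h xy.1 xy.2 ->
    KKT_multipliers f g h xy.1 xy.2 uv.1 uv.2.
  have [[sol mfcq]|no] := pselect (lower_solutions f g h xy.1 xy.2 /\ MFCQ g h xy.1 xy.2).
    have [uv uvP] := lower_kkt _ _ _ _ _ f_C2 g_C2 h_C2 sol mfcq.
    by exists uv.
  (* A dummy value makes the choice of multipliers total. *)
  by exists (0, 0) => sol mfcq; case: no.
have [uv uvP] := choice kkt_ex.
have Ukkt : \forall xy \near U, KKT_multipliers f g h xy.1 xy.2 (uv xy).1 (uv xy).2.
  by apply: filterS2 Ubad (Ubar _ near_MFCQ) => xy [[_ sol] _] /(_ sol); exact: uvP.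
have grad_cvg (c : 'rV[R]_(n + m) -> R) : C2 c ->
    grad (c \o row_mx xy.1) xy.2 @[xy --> U] --> grad (c \o row_mx xbar) ybar.
  move=> [[_ cc] _]; under eq_fun do rewrite grad_partial; rewrite grad_partial.
  exact: (continuous_cvg UP (@continuous_rsubmx _ _ _ _ _) (continuous_cvg UP (cc _) Uxy)).
have mfcq_bar : MFCQ g h xbar ybar.
  exact: (nbhs_singleton near_MFCQ bar_feasible.2).
have [] := @multipliers_cvg _ _ U _ _ _ (fun i => g (row_mx xbar ybar) 0 i == 0)
  (fun xy => grad (f \o row_mx xy.1) xy.2) (fun i xy => grad_y g xy.1 xy.2 i)
  (fun j xy => grad_y h xy.1 xy.2 j) _ _ _ (fst \o uv) (snd \o uv) UU
  (grad_cvg _ f_C2) (fun i => grad_cvg _ (g_C2 i)) (fun j => grad_cvg _ (h_C2 j)) _ _ _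
  (MFCQ_positively_independent _ _ _ _ mfcq_bar).
- by move=> i; apply: filterS Ukkt => xy [].
(* A constraint inactive at the limit is inactive nearby, where complementarity makes its multiplier
   0. *)
- move=> i gi0.
  have gi_lt0 : g (row_mx xbar ybar) 0 i < 0.
    by case: bar_feasible => _ [[gbar _] _]; rewrite lt_neqAle gi0 gbar.
  have g_cvg : g (row_mx xy.1 xy.2) 0 i @[xy --> U] --> g (row_mx xbar ybar) 0 i.
    exact: (continuous_cvg UP (differentiable_continuous ((g_C2 i).1.1 _)) Uxy).
  apply: filterS2 Ukkt (cvgr_lt _ g_cvg _ gi_lt0) => xy [_ /(_ i)/eqP + _] gxy.
  by rewrite mulf_eq0 (lt_eqF gxy) orbF => /eqP.
- by apply: cvg_near_cst; apply: filterS Ukkt => xy [].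
move=> u [v [Uu Uv u_ge0 u_off stat]].
(* Complementarity and [h = 0] make both products 0, which gives the aggregate sign condition of the
   dual. *)
have dot_compl x y (u' : 'rV[R]_p) (v' : 'rV[R]_q) :
    (forall i, u' 0 i * g (row_mx x y) 0 i = 0) -> h (row_mx x y) = 0 ->
    0 <= dotv u' (g (row_mx x y)) + dotv v' (h (row_mx x y)).
  move=> compl ->; rewrite /dotv big1 => [|i _]; last exact: compl.
  by rewrite big1 ?addr0 // => j _; rewrite mxE mulr0.
have Luv : Lambda f g h xbar ybar ybar (u, v).
  split; rewrite ?subrr // ?grad_lagrangian //.
  apply: dot_compl => [i|]; last by case: bar_feasible => _ [[]].
  by have [->|/u_off ->] := eqVneq (g (row_mx xbar ybar) 0 i) 0; rewrite ?mulr0 ?mul0r.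
have [_ opt] := MDP_optimal _ _ Luv.
have Uall : (xy.1, xy.2, xy.2, (uv xy).1, (uv xy).2) @[xy --> U] -->
    (xbar, ybar, ybar, u, v).
  have pair_cvg (V W : topologicalType) (a : V) (b : W) (r : _ -> V) (s : _ -> W) :
      r @ U --> a -> s @ U --> b -> (r t, s t) @[t --> U] --> (a, b).
    by move=> ra sb; exact: cvg_pair.
  have Uxyy := pair_cvg _ _ _ _ _ _ (pair_cvg _ _ _ _ _ _ Ux Uy) Uy.
  exact: (pair_cvg _ _ _ _ _ _ (pair_cvg _ _ _ _ _ _ Uxyy Uu) Uv).
(* Sets of a proper filter meet: one point is bad, has KKT multipliers, and lies close enough,
   together with them, for local optimality in (MDP) at the limit to apply. *)
have [xy [[[[Oxy sol] lt_obj] [xy_u_ge0 compl xy_stat]] obj_le]] :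
    exists xy, (bad xy /\ KKT_multipliers f g h xy.1 xy.2 (uv xy).1 (uv xy).2) /\
    (MDP_feasible Omega f g h (xy.1, xy.2, xy.2, (uv xy).1, (uv xy).2) ->
     F (row_mx xbar ybar) <= F (row_mx xy.1 xy.2)).
  by apply: (@filter_ex _ U); apply: filterI; [exact: filterI|exact: Uall _ opt].
move: lt_obj; rewrite /BP_objective ltNge => /negP; apply; apply: obj_le.
case: sol => -[gxy hxy] _; split => //.
- by rewrite subrr; split => //; exact: dot_compl.
- by rewrite !mulmx_jacobianT.
Qed.
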